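(* Let $p>2$ be a prime and $\lambda$ an ordering of $\mathbb{F}_p\times\mathbb{F}_p$. Let $\tilde G_\lambda$ be the self-similar closure of the Sushchansky group $G_\lambda=\langle A,B_\lambda\rangle$, let $K=\langle q_1,\dots,q_{t},r_1,\dots,r_{p^2},\sigma\rangle\le\tilde G_\lambda$, and let $K^p=\langle g^p: g\in K\rangle$. Then $\tilde G_\lambda$ is a weakly regular branch group over $K^p$.
   Context: Tree automorphisms. Let $p>2$ be a prime and $X=\{0,1,\dots,p-1\}$, identified with the field $\mathbb{F}_p$. The set $X^*$ of finite words over $X$ is a rooted $p$-ary tree (root the empty word; $w$ is joined to $wx$). For $g\in\mathrm{Aut}\,X^*$ and $v\in X^*$, the restriction $g|_v\in \mathrm{Aut}\,X^*$ is defined by $g(vw)=g(v)\,g|_v(w)$. Write $g=(g|_0,g|_1,\dots,g|_{p-1})\pi_g$, where $\pi_g$ is the permutation of $X$ induced by $g$ (omitted if trivial). In a product $gh$, $g$ acts first. Let $\sigma=(0,1,\dots,p-1)$ be the cyclic permutation $x\mapsto x+1$ of $X$; $\sigma$ also denotes the automorphism $(1,\dots,1)\sigma$. Sushchansky groups. Let $\lambda=\{(\alpha_i,\beta_i): i=1,\dots,p^2\}$ be an ordering (enumeration without repetition) of all pairs in $\mathbb{F}_p\times\mathbb{F}_p$. Put $u_i=0$, $v_i=1$ if $\beta_i=0$, and $u_i=1$, $v_i=-\alpha_i/\beta_i$ if $\beta_i\neq 0$. Define automorphisms $q_i,r_i$ ($i=1,\dots,p^2$, indices taken modulo $p^2$)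 of $X^*$ recursively by $$q_i=(q_{i+1},\sigma^{u_i},1,\dots,1),\qquad r_i=(r_{i+1},\sigma^{v_i},1,\dots,1).$$ Let $t\in\{p,p^2\}$ be the length of the minimal period of the word $u=u_1u_2\cdots u_{p^2}$, so that $q_{i+t}=q_i$ for all $i$. Let $A=(1,\sigma,\sigma^2,\dots,\sigma^{p-1})\sigma$, and let $B_\lambda$ be the automorphism acting trivially on $X^2$ with $B_\lambda|_{00}=q_1$, $B_\lambda|_{10}=r_1$, $B_\lambda|_{21}=\sigma$, and all other restrictions $B_\lambda|_{xy}$, $xy\in X^2$, trivial. The Sushchansky group of type $\lambda$ is $G_\lambda=\langle A,B_\lambda\rangle$. Self-similar closure. The self-similar closure of $G\le\mathrm{Aut}\,X^*$ is the group generated by all restrictions $g|_v$, $g\in G$, $v\in X^*$. Weakly regular branch. A group $G$ acting on $X^*$ is weakly regular branch over its subgroup $P$ if (1) $G$ acts transitively on each level $X^n$, $n\ge 0$; and (2) for some $k\ge 1$, $P$ geometrically contains the direct product of $|X|^k$ copies of $P$: for every family $(g_v)_{v\in X^k}$ of elements of $P$, the automorphism $g$ of $X^*$ that fixes $X^k$ pointwise and satisfies $g|_v=g_v$ for all $v\in X^k$ belongs to $P$. *)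

(* Defs.v *)
From HB Require Import structures.
From mathcomp Require Import all_boot all_order all_algebra all_fingroup.
From mathcomp Require Import boolp classical_sets.

Set Implicit Arguments.
Unset Strict Implicit.
Unset Printing Implicit Defensive.

Import GRing.Theory.

(* MathComp world, with the classical axioms of mathcomp.classical: they make *)
(* tree automorphisms extensional, so that Leibniz equality is the intended   *)
(* one, and equip them with the choiceType structure that groupType requires. *)

(* Automorphisms of the rooted tree X^* *)

Section TreeAut.
Variable X : finType.
Implicit Types (v w : seq X) (x y : X).

Definition tree_adj : rel (seq X) := fun v w =>
  [exists x, w == rcons v x] || [exists x, v == rcons w x].

Record treeAut := TreeAut {
  tree_fun :> seq X -> seq X;
  tree_bij : bijective tree_fun;
  tree_root : tree_fun [::] = [::];
  tree_edge : {mono tree_fun : v w / tree_adj v w}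
}.

Implicit Types g h : treeAut.

HB.instance Definition _ := gen_eqMixin treeAut.
HB.instance Definition _ := gen_choiceMixin treeAut.

Lemma treeAutP g h : g =1 h -> g = h.
Proof.
case: g h => [f bf rf ef] [f' bf' rf' ef'] /= /funext Ef.
move: bf' rf' ef'; rewrite -Ef => bf' rf' ef'.
by rewrite (Prop_irrelevance bf bf') (Prop_irrelevance rf rf')
           (Prop_irrelevance ef ef').
Qed.

Lemma tree_adjP v w :
  reflect ((exists x, w = rcons v x) \/ (exists x, v = rcons w x))
          (tree_adj v w).
Proof.
apply: (iffP orP).
  by case=> /existsP[x /eqP ->]; [left|right]; exists x.
by case=> -[x ->]; [left|right]; apply/existsP; exists x.
Qed.

Lemma tree_rcons g v x : exists y, g (rcons v x) = rcons (g v) y.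
Proof.
elim/last_ind: v x => [|v z IHv] x.
  have : tree_adj (g [::]) (g [:: x]).
    by rewrite tree_edge; apply/tree_adjP; left; exists x.
  case/tree_adjP=> -[y]; first by exists y.
  by rewrite tree_root => /(congr1 size); rewrite size_rcons.
have : tree_adj (g (rcons v z)) (g (rcons (rcons v z) x)).
  by rewrite tree_edge; apply/tree_adjP; left; exists x.
case/tree_adjP=> -[y Ey]; first by exists y.
have [t Et] := IHv z.
have /(bij_inj (tree_bij g))/(congr1 size) : g v = g (rcons (rcons v z) x).
  by move: Ey; rewrite Et => /rcons_inj[].
by rewrite !size_rcons => /eqP; rewrite -addn2 -[X in X == _]addn0 eqn_add2l.
Qed.

Lemma size_tree g v : size (g v) = size v.
Proof.
elim/last_ind: v => [|v x IHv]; first by rewrite tree_root.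
by have [y ->] := tree_rcons g v x; rewrite !size_rcons IHv.
Qed.

Lemma tree_cat g v w : take (size v) (g (v ++ w)) = g v.
Proof.
elim/last_ind: w => [|w x IHw].
  by rewrite cats0 -(size_tree g) take_size.
rewrite -rcons_cat; have [y ->] := tree_rcons g (v ++ w) x.
by rewrite -cats1 takel_cat // size_tree size_cat leq_addr.
Qed.

Section Criterion.
Variables f f' : seq X -> seq X.
Hypotheses (fK : cancel f f') (f'K : cancel f' f) (f0 : f [::] = [::]).
Hypothesis f_rcons : forall v x, exists y, f (rcons v x) = rcons (f v) y.

Fact criterion_edge : {mono f : v w / tree_adj v w}.
Proof.
have f_size v : size (f v) = size v.
  elim/last_ind: v => [|v x IHv]; first by rewrite f0.
  by have [y ->] := f_rcons v x; rewrite !size_rcons IHv.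
have back v w y : f w = rcons (f v) y -> exists x, w = rcons v x.
  elim/last_ind: w => [|w x _]; first by rewrite f0; case: (f v).
  have [z ->] := f_rcons w x.
  by move=> /rcons_inj[/(can_inj fK) -> _]; exists x.
move=> v w; apply/tree_adjP/tree_adjP.
  by case=> -[y /back]; [left|right].
by case=> -[x ->]; [left|right]; apply: f_rcons.
Qed.

Definition mk_treeAut := TreeAut (Bijective fK f'K) f0 criterion_edge.

End Criterion.

(* The group Aut X^*; in g * h the factor g acts first *)

Fact tree1_rcons v x : exists y, idfun (rcons v x) = rcons (idfun v) y.
Proof. by exists x. Qed.

Definition tree1 : treeAut :=
  @mk_treeAut idfun idfun (fun=> erefl) (fun=> erefl) erefl tree1_rcons.

Fact tree_mul_root g h : (h \o g) [::] = [::].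
Proof. by rewrite /= !tree_root. Qed.

Fact tree_mul_edge g h : {mono h \o g : v w / tree_adj v w}.
Proof. by move=> v w /=; rewrite !tree_edge. Qed.

Definition tree_mul g h : treeAut :=
  TreeAut (bij_comp (tree_bij h) (tree_bij g)) (tree_mul_root g h)
          (@tree_mul_edge g h).

Fact tree_surj g w : exists v, g v == w.
Proof. by have [f _ fK] := tree_bij g; exists (f w); rewrite fK. Qed.

Definition tree_inv_fun g w : seq X := xchoose (tree_surj g w).

Fact tree_invK g : cancel (tree_inv_fun g) g.
Proof. by move=> w; apply/eqP; apply: (xchooseP (tree_surj g w)). Qed.

Fact treeK g : cancel g (tree_inv_fun g).
Proof. by move=> v; apply: (bij_inj (tree_bij g)); rewrite tree_invK. Qed.

Fact tree_inv_root g : tree_inv_fun g [::] = [::].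
Proof. by rewrite -[in LHS](tree_root g) treeK. Qed.

Fact tree_inv_edge g : {mono tree_inv_fun g : v w / tree_adj v w}.
Proof. by move=> v w; rewrite -(tree_edge g) !tree_invK. Qed.

Definition tree_inv g : treeAut :=
  TreeAut (Bijective (@tree_invK g) (@treeK g)) (tree_inv_root g)
          (@tree_inv_edge g).

Fact tree_mulA : associative tree_mul.
Proof. by move=> f g h; apply: treeAutP. Qed.
Fact tree_mul1 : left_id tree1 tree_mul.
Proof. by move=> g; apply: treeAutP. Qed.
Fact tree_mulr1 : right_id tree1 tree_mul.
Proof. by move=> g; apply: treeAutP. Qed.
Fact tree_mulV : left_inverse tree1 tree_inv tree_mul.
Proof. by move=> g; apply: treeAutP => w /=; rewrite tree_invK. Qed.
Fact tree_mulrV : right_inverse tree1 tree_inv tree_mul.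
Proof. by move=> g; apply: treeAutP => w /=; rewrite treeK. Qed.

HB.instance Definition _ := isGroup.Build treeAut
  tree_mulA tree_mul1 tree_mulr1 tree_mulV tree_mulrV.

Lemma tree1E w : (1%g : treeAut) w = w. Proof. by []. Qed.
Lemma treeME g h w : (g * h)%g w = h (g w). Proof. by []. Qed.

(* Restriction to a subtree *)

Definition restr_fun g v w := drop (size v) (g (v ++ w)).

Lemma tree_catE g v w : g (v ++ w) = g v ++ restr_fun g v w.
Proof. by rewrite -[LHS](cat_take_drop (size v)) tree_cat. Qed.

Fact restr_root g v : restr_fun g v [::] = [::].
Proof. by rewrite /restr_fun cats0 -(size_tree g) drop_size. Qed.

Fact restr_rcons g v w x :
  exists y, restr_fun g v (rcons w x) = rcons (restr_fun g v w) y.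
Proof.
rewrite /restr_fun -rcons_cat; have [y ->] := tree_rcons g (v ++ w) x.
by exists y; rewrite drop_rcons // size_tree size_cat leq_addr.
Qed.

Fact restrK g v : cancel (restr_fun g v) (restr_fun (tree_inv g) (g v)).
Proof.
move=> w; rewrite /(restr_fun (tree_inv g)) -tree_catE /= treeK.
by rewrite size_tree drop_size_cat.
Qed.

Fact restrVK g v : cancel (restr_fun (tree_inv g) (g v)) (restr_fun g v).
Proof.
move=> w; have := tree_catE (tree_inv g) (g v) w; rewrite /= treeK => Ew.
by rewrite /(restr_fun g) -Ew tree_invK -(size_tree g) drop_size_cat.
Qed.

Definition restr g v : treeAut :=
  mk_treeAut (@restrK g v) (@restrVK g v) (restr_root g v) (@restr_rcons g v).

Lemma restrE g v w : g (v ++ w) = g v ++ restr g v w.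
Proof. exact: tree_catE. Qed.

(* node f s is the automorphism (f 0, ..., f (p-1)) s *)

Section Node.
Variables (f : X -> treeAut) (s : {perm X}).

Definition node_fun w := if w is x :: w' then s x :: f x w' else [::].
Definition node_inv w :=
  if w is y :: w' then (s^-1 y :: (f (s^-1 y))^-1 w')%g else [::].

Fact node_funK : cancel node_fun node_inv.
Proof. by case=> //= x w; rewrite permK; congr (_ :: _); apply: treeK. Qed.

Fact node_invK : cancel node_inv node_fun.
Proof. by case=> //= x w; rewrite permKV; congr (_ :: _); apply: tree_invK. Qed.

Fact node_rcons v x : exists y, node_fun (rcons v x) = rcons (node_fun v) y.
Proof.
case: v => [|z v] /=; first by exists (s x); rewrite tree_root.
by have [y ->] := tree_rcons (f z) v x; exists y.
Qed.

Definition node : treeAut := mk_treeAut node_funK node_invK erefl node_rcons.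

End Node.

(* Subgroups of Aut X^* *)

Local Open Scope classical_set_scope.
Implicit Types G P S : set treeAut.

Definition is_subgroup (H : set treeAut) : Prop :=
  [/\ H 1%g, forall g h, H g -> H h -> H (g * h)%g
    & forall g, H g -> H g^-1%g].

Definition gen_subgroup S : set treeAut := smallest is_subgroup S.

Definition self_similar_closure G : set treeAut :=
  gen_subgroup [set h | exists2 g, G g & exists v, h = restr g v].

Definition power_subgroup G n : set treeAut :=
  gen_subgroup [set (g ^+ n)%g | g in G].

Definition level_transitive G : Prop :=
  forall n (v w : n.-tuple X), exists2 g, G g & g v = w :> seq X.

(* The automorphism h below exists (geom_family_ex) and is unique. *)
Definition geom_contains P k : Prop :=
  forall gs : k.-tuple X -> treeAut, (forall v : k.-tuple X, P (gs v)) ->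
  forall h, (forall v : k.-tuple X, h v = v :> seq X /\ restr h v = gs v) ->
  P h.

Definition weakly_regular_branch G P : Prop :=
  [/\ is_subgroup G, is_subgroup P, P `<=` G, level_transitive G
    & exists2 k, (0 < k)%N & geom_contains P k].

Fixpoint geom_family k (gs : seq X -> treeAut) : treeAut :=
  if k is k'.+1 then node (fun x => geom_family k' (fun v => gs (x :: v))) 1
  else gs [::].

Lemma geom_family_ex k (gs : k.-tuple X -> treeAut) :
  exists h, forall v : k.-tuple X, h v = v :> seq X /\ restr h v = gs v.
Proof.
pose gs' (w : seq X) := if insub w is Some t then gs t else 1%g.
suff H : forall w (c : seq X -> treeAut), size w = k ->
    geom_family k c w = w /\ restr (geom_family k c) w = c w.
  exists (geom_family k gs') => v; have [-> ->] := H v gs' (size_tuple v).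
  by rewrite /gs' valK.
elim: k {gs gs'} => [|k IHk] [|x w] c //=.
  by split; [apply: tree_root | apply: treeAutP => u; rewrite /= /restr_fun drop0].
case=> /(IHk _ (fun v => c (x :: v)))[cw rw].
by split; [rewrite perm1 cw | rewrite -rw; apply: treeAutP => u].
Qed.

End TreeAut.

(* Sushchansky groups *)

Section Sushchansky.
Variable p : nat.
Local Open Scope ring_scope.

Definition sigma_perm : {perm 'F_p} := perm (addIr (1 : 'F_p)).

Definition sigma : treeAut 'F_p := node (fun=> 1%g) sigma_perm.

(* comb a i is the automorphism (comb a (i + 1), a i, 1, ..., 1): see combE. *)

Fixpoint comb_fun (a : 'Z_(p ^ 2) -> treeAut 'F_p) (i : 'Z_(p ^ 2))
    (w : seq 'F_p) : seq 'F_p :=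
  if w is x :: w' then
    x :: (if x == 0 then comb_fun a (i + 1) w'
          else if x == 1 then a i w' else w')
  else [::].

Section Comb.
Variables (a : 'Z_(p ^ 2) -> treeAut 'F_p) (i : 'Z_(p ^ 2)).

Fact comb_funK : cancel (comb_fun a i) (comb_fun (fun j => (a j)^-1)%g i).
Proof.
move=> w; elim: w i => //= x w IHw j; congr (_ :: _).
by case: (x == 0) => //; case: (x == 1) => //; apply: treeK.
Qed.

Fact comb_invK : cancel (comb_fun (fun j => (a j)^-1)%g i) (comb_fun a i).
Proof.
move=> w; elim: w i => //= x w IHw j; congr (_ :: _).
by case: (x == 0) => //; case: (x == 1) => //; apply: tree_invK.
Qed.

Fact comb_rcons v x : exists y, comb_fun a i (rcons v x) = rcons (comb_fun a i v) y.
Proof.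
elim: v i => [|z v IHv] j /=.
  by exists x; case: ifP => // _; case: ifP; rewrite ?tree_root.
case: ifP => _; first by have [y ->] := IHv (j + 1); exists y.
case: ifP => _; last by exists x.
by have [y ->] := tree_rcons (a j) v x; exists y.
Qed.

Definition comb : treeAut 'F_p := mk_treeAut comb_funK comb_invK erefl comb_rcons.

End Comb.

Lemma combE a i :
  comb a i = node (fun x => if x == 0 then comb a (i + 1)
                            else if x == 1 then a i else 1%g) 1%g.
Proof.
apply: treeAutP => -[|x w] //=; rewrite perm1; congr (_ :: _).
by case: ifP => // _; case: ifP.
Qed.

(* The ordering lam is indexed by residues modulo p ^ 2, so that the residue  *)
(* of i stands for the index i = 1, ..., p ^ 2 and i + 1 is cyclic.           *)
Variable lam : 'Z_(p ^ 2) -> 'F_p * 'F_p.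

Definition susch_u i : 'F_p := if (lam i).2 == 0 then 0 else 1.

Definition susch_v i : 'F_p :=
  if (lam i).2 == 0 then 1 else - (lam i).1 / (lam i).2.

(* The exponents are coerced from 'F_p to nat: sigma has order p. *)
Definition susch_q := comb (fun i => sigma ^+ susch_u i)%g.
Definition susch_r := comb (fun i => sigma ^+ susch_v i)%g.

Definition cyclic_period (t : nat) : bool :=
  (0 < t)%N && [forall i, susch_u (i + t%:R) == susch_u i].

Fact cyclic_period_ex : exists t, cyclic_period t.
Proof.
exists (Zp_trunc (p ^ 2)).+2; apply/andP; split=> //; apply/forallP => i.
suff -> : (Zp_trunc (p ^ 2)).+2%:R = 0 :> 'Z_(p ^ 2) by rewrite addr0.
by apply/val_inj; rewrite Zp_nat /= modnn.
Qed.

Definition susch_t : nat := ex_minn cyclic_period_ex.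

Definition susch_A : treeAut 'F_p := node (fun x : 'F_p => sigma ^+ x)%g sigma_perm.

Definition susch_B : treeAut 'F_p :=
  node (fun x : 'F_p => node (fun y : 'F_p =>
    if (x, y) == (0, 0) then susch_q 1
    else if (x, y) == (1, 0) then susch_r 1
    else if (x, y) == (2%:R, 1) then sigma
    else 1%g) 1%g) 1%g.

Local Open Scope classical_set_scope.

Definition sushchansky : set (treeAut 'F_p) := gen_subgroup [set susch_A; susch_B].

Definition susch_K : set (treeAut 'F_p) :=
  gen_subgroup ([set susch_q i%:R | i in [set i : nat | (1 <= i <= susch_t)%N]]
         `|` [set susch_r i%:R | i in [set i : nat | (1 <= i <= p ^ 2)%N]]
         `|` [set sigma]).

End Sushchansky.

(* Main.v *)
Require Import Defs.
From mathcomp Require Import all_boot all_order all_algebra all_fingroup.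
From mathcomp Require Import boolp classical_sets.

(** Let [s] be a generator [r_i] with [v_i = 1].  The elements [q_j], [r_j] and
    [sigma * s * sigma^-1 = (sigma, 1, ..., 1, r_(i+1))] of [K] fix the first
    level, and their restrictions at 0 generate [K].  At the letters other than
    0 they restrict to powers of [sigma] (letter 1), powers of [r_(i+1)]
    (letter -1, distinct from 1 because [p > 2]) or 1, all of order dividing
    [p].  Hence every [h] in [K] lifts to some [(h, a_1, ..., a_(p-1))] in [K]
    with [a_j ^ p = 1], and the [p]-th power of the lift is
    [(h ^ p, 1, ..., 1)].  Conjugating by [sigma] reaches every letter, so [K^p]
    geometrically contains [p] copies of itself; the lifts together with [sigma]
    also make [K] transitive on levels. *)

Local Open Scope classical_set_scope.
Local Open Scope group_scope.

Import GRing.Theory.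

(** * Generated subgroups and finite cyclic subgroups *)

Section Subgroups.
Variable X : finType.
Implicit Types (S H : set (treeAut X)) (g h : treeAut X).

Lemma gen_subgroup_is_subgroup S : is_subgroup (gen_subgroup S).
Proof.
split=> [|g h Sg Sh|g Sg] H [sgH SH].
- by case: sgH.
- by case: (sgH) => _ HM _; apply: HM; [apply: Sg|apply: Sh].
- by case: (sgH) => _ _ HV; apply: HV; apply: Sg.
Qed.

Lemma sub_gen_subgroup S : S `<=` gen_subgroup S.
Proof. by move=> g Sg H [_]; apply. Qed.

Lemma gen_subgroup_sub S H : is_subgroup H -> S `<=` H -> gen_subgroup S `<=` H.
Proof. by move=> sgH SH g; apply. Qed.

Lemma subgroupX H g n : is_subgroup H -> H g -> H (g ^+ n).
Proof.
move=> [H1 HM _] Hg; elim: n => [|n IHn]; first by rewrite expg0.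
by rewrite expgS; apply: HM.
Qed.

Lemma power_subgroup_sub H n : is_subgroup H -> power_subgroup H n `<=` H.
Proof.
by move=> sgH; apply: gen_subgroup_sub => // _ [g Hg <-]; apply: subgroupX.
Qed.

(** Natural exponents suffice: for [g] of finite order they already give the cyclic subgroup. *)
Definition powers g : set (treeAut X) := [set g ^+ n | n in [set: nat]].

Lemma powers_subgroup g n : (0 < n)%N -> g ^+ n = 1 -> is_subgroup (powers g).
Proof.
move=> n0 gn; split; first by exists 0%N.
  by move=> _ _ [k _ <-] [l _ <-]; exists (k + l)%N => //; rewrite expgnDr.
move=> _ [k _ <-]; exists (k * n.-1)%N => //.
apply/(mulgI (g ^+ k)); rewrite mulgV -expgnDr -mulnS prednK //.
by rewrite mulnC expgM gn expg1n.
Qed.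

Lemma powers_expg g n h : g ^+ n = 1 -> powers g h -> h ^+ n = 1.
Proof. by move=> gn [k _ <-]; rewrite -expgM mulnC expgM gn expg1n. Qed.

End Subgroups.

Arguments powers {X} g.

(** * First-level decomposition of automorphisms *)

Section Nodes.
Variable X : finType.
Implicit Types (f g : X -> treeAut X) (s t : {perm X}).

Lemma nodeM f g s t :
  node f s * node g t = node (fun x => f x * g (s x)) (s * t).
Proof. by apply: treeAutP => -[|x w] //=; rewrite permM. Qed.

Lemma node_eq f g s : f =1 g -> node f s = node g s.
Proof. by move=> /funext ->. Qed.

Lemma node1 : node (fun=> 1) 1 = 1 :> treeAut X.
Proof. by apply: treeAutP => -[|x w] //=; rewrite perm1. Qed.

Lemma node1M f g : node f 1 * node g 1 = node (fun x => f x * g x) 1.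
Proof. by rewrite nodeM mulg1; apply: node_eq => x; rewrite perm1. Qed.

Lemma node1V f : (node f 1)^-1 = node (fun x => (f x)^-1) 1.
Proof.
apply: (mulgI (node f 1)); rewrite mulgV node1M -node1.
by apply: node_eq => x; rewrite mulgV.
Qed.

Lemma node1X f n : node f 1 ^+ n = node (fun x => f x ^+ n) 1.
Proof.
elim: n => [|n IHn].
  by rewrite expg0 -node1; apply: node_eq => x; rewrite expg0.
by rewrite expgS IHn node1M; apply: node_eq => x; rewrite expgS.
Qed.

Lemma restr_cat (g : treeAut X) v w : restr g (v ++ w) = restr (restr g v) w.
Proof.
apply: treeAutP => u; have := restrE g (v ++ w) u.
rewrite -catA restrE (restrE (restr g v)) (restrE g v) -catA.
move/(congr1 (drop (size (g v)))); rewrite !drop_size_cat //.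
move/(congr1 (drop (size (restr g v w)))); rewrite !drop_size_cat //.
Qed.

Lemma restr_nil (g : treeAut X) : restr g [::] = g.
Proof. by apply: treeAutP => u; rewrite /= /restr_fun drop0. Qed.

Lemma restr_node f s x : restr (node f s) [:: x] = f x.
Proof. by apply: treeAutP => u; rewrite /= /restr_fun /= drop0. Qed.

Lemma node_restr (h : treeAut X) : (forall x, h [:: x] = [:: x]) ->
  h = node (fun x => restr h [:: x]) 1.
Proof.
move=> fix_h; apply: treeAutP => -[|x w]; first by rewrite !tree_root.
by rewrite -cat1s restrE fix_h /= perm1.
Qed.

(** [node g 1] is the product, over all letters, of nodes supported on a single letter. *)
Lemma node_supported H (g : X -> treeAut X) : is_subgroup H ->
  (forall x, H (node (fun y => if y == x then g x else 1) 1)) ->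
  H (node g 1).
Proof.
move=> [H1 HM _] Hg.
suff Hs (s : seq X) : uniq s -> H (node (fun y => if y \in s then g y else 1) 1).
  rewrite (@node_eq _ (fun y => if y \in enum X then g y else 1)).
    by apply: Hs; apply: enum_uniq.
  by move=> x; rewrite mem_enum.
elim: s => [_|x s IHs /= /andP[xs us]]; first by rewrite /= node1.
have := HM _ _ (Hg x) (IHs us); rewrite node1M; congr (H _); apply: node_eq => y.
rewrite inE; case: eqP => [->|_]; last by rewrite mul1g.
by rewrite (negbTE xs) mulg1.
Qed.

End Nodes.

(** * Automorphisms directed along the ray of zeros *)

Section Comb.
Variable p : nat.
Implicit Type a : 'Z_(p ^ 2) -> treeAut 'F_p.

Lemma comb1 i : comb (fun=> 1) i = 1 :> treeAut 'F_p.
Proof.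
apply: treeAutP => w /=; elim: w i => //= x w IHw i.
by rewrite IHw; do 2?case: ifP.
Qed.

Lemma combM a b i : comb a i * comb b i = comb (fun j => a j * b j) i.
Proof.
apply: treeAutP => w /=; elim: w i => //= x w IHw i.
by case: (x == 0%R); rewrite ?IHw //; case: (x == 1%R).
Qed.

Lemma combX a i n : comb a i ^+ n = comb (fun j => a j ^+ n) i.
Proof.
elim: n => [|n IHn].
  by rewrite expg0 -[LHS](comb1 i).
by rewrite expgS IHn combM; congr comb; apply: funext => j; rewrite expgS.
Qed.

Lemma comb_shift a i (c : 'Z_(p ^ 2)) :
  (forall j, a (j + c)%R = a j) -> comb a (i + c)%R = comb a i.
Proof.
move=> ac; apply: treeAutP => w /=; elim: w i => //= x w IHw i.
by rewrite ac addrAC IHw.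
Qed.

Lemma restr_comb_nseq0 a i n :
  restr (comb a i) (nseq n 0%R) = comb a (i + n%:R)%R.
Proof.
elim: n i => [|n IHn] i; first by rewrite restr_nil addr0.
rewrite -[nseq _ _]/([:: 0%R] ++ nseq n 0%R) restr_cat combE restr_node eqxx IHn.
by rewrite -addrA -mulrS.
Qed.

End Comb.

(** * Powers of [sigma] as translations of the first letter *)

Section Sigma.
Variables (p : nat) (p_prime : prime p).
Local Notation sigma := (sigma p).

Lemma sigmaX_cons n (x : 'F_p) w : (sigma ^+ n) (x :: w) = (x + n%:R)%R :: w.
Proof.
elim: n x => [|n IHn] x; first by rewrite expg0 addr0.
by rewrite expgS treeME /= permE IHn -addrA -mulrS.
Qed.

Lemma sigma_expg : sigma ^+ p = 1.
Proof.
apply: treeAutP => -[|x w]; first by rewrite tree_root.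
by rewrite sigmaX_cons pchar_Fp_0 // addr0.
Qed.

(** The left factor acts first and moves [x] to [x + n], so [f] is read there; the last factor moves
    the letter back. *)
Lemma node_conj_sigmaX (f : 'F_p -> treeAut 'F_p) n :
  sigma ^+ n * node f 1 * (sigma ^+ n)^-1 = node (fun x => f (x + n%:R)%R) 1.
Proof.
apply: (mulIg (sigma ^+ n)); rewrite mulgKV.
apply: treeAutP => -[|x w]; first by rewrite !tree_root.
by rewrite !treeME sigmaX_cons /= !perm1 sigmaX_cons.
Qed.

Lemma node_translate H f (c : 'F_p) : is_subgroup H -> H sigma ->
  H (node f 1) -> H (node (fun x => f (x + c)%R) 1).
Proof.
move=> sgH Hs Hf; rewrite -[c]natr_Zp -node_conj_sigmaX.
have Hc := subgroupX _ _ _ (c : nat) sgH Hs; case: sgH => _ HM HV.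
exact: (HM _ _ (HM _ _ Hc Hf) (HV _ Hc)).
Qed.

End Sigma.

(** * Lifting, transitivity and branching for [K] *)

Section Sushchansky.
Variables (p : nat) (p_prime : prime p) (p_gt2 : (2 < p)%N).
Variables (lam : 'Z_(p ^ 2) -> 'F_p * 'F_p) (lam_bij : bijective lam).
Local Notation sigma := (sigma p).
Local Notation K := (susch_K lam).

Lemma K_subgroup : is_subgroup K.
Proof. exact: gen_subgroup_is_subgroup. Qed.

Lemma K_sigma : K sigma.
Proof. by apply: sub_gen_subgroup; right. Qed.

Lemma susch_q_period i : susch_q lam (i + (susch_t lam)%:R)%R = susch_q lam i.
Proof.
rewrite /susch_t; case: ex_minnP => t /andP[_ /forallP per_t] _.
by apply: comb_shift => j; rewrite (eqP (per_t j)).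
Qed.

Lemma K_q i : K (susch_q lam i).
Proof.
have t0 : (0 < susch_t lam)%N.
  by rewrite /susch_t; case: ex_minnP => t /andP[].
suff Kq n : K (susch_q lam n%:R%R) by rewrite -[i]natr_Zp.
(* Adding a period first keeps the predecessor from truncating at [n = 0]; the reduced index then
   lies between 1 and [susch_t lam]. *)
pose m := (n + susch_t lam)%N.-1.
have -> : susch_q lam n%:R%R = susch_q lam (m %% susch_t lam).+1%:R%R.
  rewrite -(susch_q_period n%:R%R) -natrD -[(n + _)%N]prednK ?addn_gt0 ?t0 ?orbT //.
  rewrite -/m [in LHS](divn_eq m (susch_t lam)) -addnS.
  elim: (m %/ _)%N => [|d IHd]; first by rewrite mul0n add0n.
  by rewrite mulSn -addnA addnC natrD susch_q_period.
apply: sub_gen_subgroup; left; left; exists (m %% susch_t lam).+1 => //=.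
by rewrite ltn_mod.
Qed.

Lemma K_r i : K (susch_r lam i).
Proof.
apply: sub_gen_subgroup; left; right; have p2_gt1 : (1 < p ^ 2)%N.
  by rewrite -[1%N](exp1n 2) ltn_exp2r ?prime_gt1.
have p2_eq0 : (p ^ 2)%:R%R = 0%R :> 'Z_(p ^ 2) by rewrite pchar_Zp.
(* Residue 0 is listed among the generators as the index [p ^ 2]. *)
have [i0|i_gt0] := posnP i.
  exists (p ^ 2)%N; first by rewrite /= leqnn (ltnW p2_gt1).
  by rewrite p2_eq0; congr susch_r; apply: val_inj; rewrite /= i0.
exists (i : nat); last by rewrite natr_Zp.
by rewrite /= i_gt0 ltnW // -{2}(Zp_cast p2_gt1) ltn_ord.
Qed.

Lemma susch_r_expg i : susch_r lam i ^+ p = 1.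
Proof.
rewrite combX -(comb1 _ i); congr comb; apply: funext => j.
by rewrite -expgM mulnC expgM sigma_expg // expg1n.
Qed.

(** Having order dividing [p] need not survive products, so the induction over generators confines
    the restriction at each letter [x] to one cyclic group [powers (s x)], the same for all [h]. *)
Lemma K_lift h (c : 'F_p) : K h -> exists f,
  [/\ K (node f 1), f c = h & forall x : 'F_p, x != c -> f x ^+ p = 1].
Proof.
have [K1 KM KV] := K_subgroup.
(* [i] is the index of the pair (0, 0), whose zero second entry forces [v_i = 1]. *)
have [lam' _ lam'K] := lam_bij; pose i := lam' (0, 0)%R.
have vi : susch_v lam i = 1%R by rewrite /susch_v lam'K eqxx.
have one_nat : (1%R : 'F_p) = 1%N :> nat by [].
pose s (x : 'F_p) : treeAut 'F_p :=
  if x == 1%R then sigma else if x == (- 1)%R then susch_r lam (i + 1)%R else 1.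
have s_p x : s x ^+ p = 1.
  rewrite /s; case: ifP => _; first exact: sigma_expg.
  by case: ifP => _; [apply: susch_r_expg | rewrite expg1n].
have s_subgroup x : is_subgroup (powers (s x)).
  exact: powers_subgroup _ _ _ (prime_gt0 p_prime) (s_p x).
have powers1 g : powers g (1 : treeAut 'F_p) by exists 0%N.
have powersX g n : powers g (g ^+ n : treeAut 'F_p) by exists n.
pose L := [set h | exists f, [/\ K (node f 1), f 0%R = h
                              & forall x : 'F_p, x != 0%R -> powers (s x) (f x)]].
have L_comb a j : K (comb (fun k => sigma ^+ a k) j) ->
    L (comb (fun k => sigma ^+ a k) (j + 1)%R).
  rewrite combE => Ka; eexists; split; [exact: Ka | by [] |].
  move=> x x0; rewrite /= (negbTE x0) /s; case: ifP => // _.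
suff KL : K `<=` L.
  (* [L] provides lifts at the letter 0; a translation carries them to [c]. *)
  move=> /KL[f [Kf f0 fs]]; exists (fun x => f (x - c)%R); split.
  - exact: node_translate _ _ _ _ K_subgroup K_sigma Kf.
  - by rewrite subrr.
  - move=> x xc; apply: powers_expg _ _ _ _ (s_p (x - c)%R) (fs _ _).
    by rewrite subr_eq0.
apply: gen_subgroup_sub.
  split.
  - by exists (fun=> 1); split=> //; rewrite node1.
  - move=> g g' [f [Kf <- fs]] [f' [Kf' <- f's]].
    exists (fun x => f x * f' x); split=> //; first by rewrite -node1M; apply: KM.
    by move=> x x0; have [_ sM _] := s_subgroup x; apply: sM; auto.
  - move=> g [f [Kf <- fs]]; exists (fun x => (f x)^-1); split=> //.
      by rewrite -node1V; apply: KV.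
    by move=> x x0; have [_ _ sV] := s_subgroup x; apply: sV; auto.
move=> _ [[[j _ <-]|[j _ <-]]|->].
(* [q_j] is the restriction of [q_(j-1)] at 0, and likewise for [r_j]. *)
- by rewrite -[j%:R%R](subrK 1%R); apply: L_comb; apply: K_q.
- by rewrite -[j%:R%R](subrK 1%R); apply: L_comb; apply: K_r.
(* [sigma] is the restriction of [r_i] at 1; the translation brings it to 0 and [r_(i+1)] to -1. *)
have := K_r i; rewrite /susch_r combE.
move=> /(node_translate _ _ _ 1%R K_subgroup K_sigma) Kr.
eexists; split; [exact: Kr | |] => /=.
  by rewrite vi one_nat expg1.
(* As [p > 2], the difference 2 is nonzero, so [sigma] and [r_(i+1)] govern different letters. *)
have N1 : (- 1 == 1 :> 'F_p)%R = false.
  apply/negbTE; rewrite eq_sym -subr_eq0 opprK -(natrD _ 1 1).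
  by rewrite -(dvdn_pcharf (pchar_Fp p_prime)) gtnNdvd.
move=> x x0; have -> : (x + 1 == 1)%R = false by rewrite -subr_eq0 addrK (negbTE x0).
rewrite addr_eq0 /s; case: (x =P (- 1)%R) => [->|_]; last by case: ifP.
by rewrite N1; exists 1%N; rewrite ?expg1.
Qed.

Lemma K_level_transitive : level_transitive K.
Proof.
have [K1 KM _] := K_subgroup.
move=> n v w; have := etrans (size_tuple v) (esym (size_tuple w)).
move: (tval v) (tval w) => {}v {}w.
elim: v w => [|x v IHv] [|y w] //= => [_|[/IHv[g Kg gv]]].
  by exists 1.
(* The lift keeps [x] and acts as [g] below it; a power of [sigma] then turns [x] into [y] without
   touching the tail. *)
have [f [Kf fx _]] := K_lift g x Kg.
exists (node f 1 * sigma ^+ (y - x)%R).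
  exact: (KM _ _ Kf (subgroupX _ _ _ _ K_subgroup K_sigma)).
rewrite treeME -[node f 1 _]/((1 : {perm 'F_p}) x :: f x v) perm1 fx gv sigmaX_cons.
by rewrite natr_Zp addrC subrK.
Qed.

Lemma K_power_geom_contains : geom_contains (power_subgroup K p) 1.
Proof.
have sgKp := gen_subgroup_is_subgroup _ [set g ^+ p | g in K].
move=> gs Kgs h hgs; pose g x := gs [tuple x].
have -> : h = node g 1.
  rewrite [LHS]node_restr => [|x]; last by case: (hgs [tuple x]).
  by apply: node_eq => x; case: (hgs [tuple x]).
apply: (node_supported _ _ _ sgKp) => x.
(* [D] is a subgroup, so only the generators [k ^+ p] with [k] in [K] remain to be checked. *)
pose D := [set k | power_subgroup K p (node (fun y => if y == x then k else 1) 1)].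
suff: D (g x) by [].
apply: (gen_subgroup_sub _ _ D) (Kgs _).
  have [H1 HM HV] := sgKp; split=> [|k l Dk Dl|k Dk]; rewrite /D /=.
  - by rewrite (@node_eq _ _ (fun=> 1)) ?node1 // => y; case: ifP.
  - have := HM _ _ Dk Dl; rewrite node1M; congr (power_subgroup _ _ _).
    by apply: node_eq => y; case: ifP => // _; rewrite mulg1.
  - have := HV _ Dk; rewrite node1V; congr (power_subgroup _ _ _).
    by apply: node_eq => y; case: ifP => // _; rewrite invg1.
(* The [p]-th power of a lift of [k] at [x] has [k ^+ p] at [x] and 1 at all other letters. *)
move=> _ [k Kk <-]; have [f [Kf fx f1]] := K_lift k x Kk.
apply: sub_gen_subgroup; exists (node f 1) => //; rewrite node1X.
by apply: node_eq => y; case: eqP => [->|/eqP /f1]; rewrite ?fx.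
Qed.

(** All generators are restrictions of [susch_B lam]: zeros appended to 00 and 10 run through the
    [q_j] and [r_j], and 21 gives [sigma]. *)
Lemma K_sub_closure : K `<=` self_similar_closure (sushchansky lam).
Proof.
have GB v : self_similar_closure (sushchansky lam) (restr (susch_B lam) v).
  apply: sub_gen_subgroup; exists (susch_B lam); last by exists v.
  by apply: sub_gen_subgroup; right.
(* The letter 2 differs from 0 and 1, so 21 falls into the third case of [susch_B]. *)
have two_neq (x : 'I_2) : (2%:R == x%:R :> 'F_p)%R = false.
  apply/negbTE; rewrite -subr_eq0 -natrB; last exact: ltnW.
  rewrite -(dvdn_pcharf (pchar_Fp p_prime)) gtnNdvd // ?subn_gt0 //.
  exact: leq_ltn_trans (leq_subr _ _) p_gt2.
apply: gen_subgroup_sub; first exact: gen_subgroup_is_subgroup.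
move=> _ [[[[|n] //= _ <-]|[[|n] //= _ <-]]|->].
- have := GB ([:: 0; 0] ++ nseq n 0)%R.
  rewrite restr_cat (restr_cat _ _ [:: 0%R] [:: 0%R]) !restr_node eqxx.
  by rewrite restr_comb_nseq0 -mulrS.
- have := GB ([:: 1; 0] ++ nseq n 0)%R.
  rewrite restr_cat (restr_cat _ _ [:: 1%R] [:: 0%R]) !restr_node.
  by rewrite !xpair_eqE oner_eq0 !eqxx /= restr_comb_nseq0 -mulrS.
- have := GB [:: 2%:R; 1]%R.
  rewrite (restr_cat _ _ [:: 2%:R%R] [:: 1%R]) !restr_node !xpair_eqE.
  by rewrite (two_neq ord0) (two_neq ord_max) !eqxx.
Qed.

End Sushchansky.

Theorem proposition6 (p : nat) (p_prime : prime p) (p_gt2 : (2 < p)%N)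
    (lam : 'Z_(p ^ 2) -> 'F_p * 'F_p) (lam_bij : bijective lam) :
  let Gt := self_similar_closure (sushchansky lam) in
  let K := susch_K lam in
  K `<=` Gt /\ weakly_regular_branch Gt (power_subgroup K p).
Proof.
move=> Gt K; have KG : K `<=` Gt by apply: K_sub_closure.
split=> //; split.
- exact: gen_subgroup_is_subgroup.
- exact: gen_subgroup_is_subgroup.
- by apply: subset_trans KG; apply: power_subgroup_sub; apply: K_subgroup.
(* Transitivity passes from [K] to the larger group [Gt]. *)
- move=> n v w; have [g Kg gv] := K_level_transitive _ p_prime p_gt2 _ lam_bij n v w.
  by exists g => //; apply: KG.
- by exists 1%N => //; apply: K_power_geom_contains.
Qed.
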